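(* Let $m$ be a nonnegative integer and let $$A_m=\left\{\sum_{b\in B}b\ \Big|\ B\subseteq\bigcup_{i=0}^m\left\{2\cdot(2^i\cdot29^{m-i}),\ 6\cdot(2^i\cdot29^{m-i}),\ 11\cdot(2^i\cdot29^{m-i})\right\}\right\}.$$ Then the modular Stanley sequence $S(A_m)=(a_n)_{n\ge0}$ satisfies $$\liminf_{n\to\infty}(a_{n+1}-a_n)=2^{m+1}.$$
   Context: A set of integers is 3-free if it contains no three distinct terms in arithmetic progression. For a finite 3-free set $A=\{a_0<\cdots<a_k\}$ of nonnegative integers, the Stanley sequence $S(A)=(a_n)_{n\ge 0}$ is defined greedily: once $a_0<\cdots<a_n$ (with $n\ge k$) are defined, $a_{n+1}$ is the smallest integer greater than $a_n$ such that $\{a_0,\ldots,a_{n+1}\}$ is 3-free. For a positive integer $N$ and $A\subseteq\{0,\ldots,N-1\}$: $A$ is 3-free modulo $N$ if there are no $x,y,z\in A$, not all equal, with $2y-z\equiv x\pmod N$; an integer $x$ is covered by $A$ modulo $N$ if there exist $y,z\in A$ with $z<y$ and $2y-z\equiv x\pmod N$. $A$ is a modular set modulo $N$ if $0\in A\subseteq\{0,\ldots,N-1\}$, $A$ is 3-free modulo $N$, and every $x\in\{0,\ldots,N-1\}\setminus A$ is covered by $A$ modulo $N$; then $S(A)$ is called a modular Stanley sequence modulo $N$. The set $A_m$ is a modular set modulo $29^{m+1}$ (in particular it is 3-free, so $S(A_m)$ is defined). *)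

(* Defs.v *)
From HB Require Import structures.
From mathcomp Require Import all_boot all_order all_algebra.
From mathcomp Require Import finmap.
From mathcomp Require Import boolp classical_sets reals ereal sequences.

Set Implicit Arguments.
Unset Strict Implicit.
Unset Printing Implicit Defensive.

(* Sets of nonnegative integers are given by a [seq nat]; a finite set
   [A : {fset nat}] coerces to the sequence of its elements. *)
Definition three_free (s : seq nat) : Prop :=
  forall x y z, x \in s -> y \in s -> z \in s ->
    x < y -> y < z -> x + z <> 2 * y.

Definition is_greedy_next (s : seq nat) (x : nat) : Prop :=
  [/\ last 0 s < x, three_free (rcons s x) &
      forall y, last 0 s < y -> three_free (rcons s y) -> x <= y].

(* The element satisfying [is_greedy_next s] is unique, and if s is an
   increasing 3-free sequence it exists, since 2 * last 0 s + 1 may be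
   appended to s; the default value 0 is then never used. *)
Definition greedy_next (s : seq nat) : nat :=
  xget 0 [set x | is_greedy_next s x]%classic.

Definition greedy_extend (s : seq nat) : seq nat := rcons s (greedy_next s).

(* [stanley A n] is the term a_n of S(A), for A nonempty and 3-free: after n
   greedy steps the prefix a_0 < ... < a_(k + n) has been built, where
   k + 1 = #|A|, and it contains a_n. *)
Definition stanley (A : {fset nat}) (n : nat) : nat :=
  nth 0 (iter n greedy_extend (sort leq A)) n.

Definition three_free_mod (N : nat) (A : {fset nat}) : Prop :=
  forall x y z, x \in A -> y \in A -> z \in A ->
    (2 * y%:Z - z%:Z = x%:Z %[mod N%:Z])%Z -> x = y /\ y = z.

Definition covered_mod (N : nat) (A : {fset nat}) (x : int) : Prop :=
  exists y z : nat, [/\ y \in A, z \in A, z < y &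
    (2 * y%:Z - z%:Z = x %[mod N%:Z])%Z].

Definition modular_set (N : nat) (A : {fset nat}) : Prop :=
  [/\ 0 < N,
      0 \in A,
      forall x, x \in A -> x < N,
      three_free_mod N A &
      forall x : nat, x < N -> x \notin A -> covered_mod N A x%:Z].

Definition generators (m : nat) : {fset nat} :=
  (\bigcup_(i <- iota 0 m.+1)
    [fset 2 * (2 ^ i * 29 ^ (m - i)); 6 * (2 ^ i * 29 ^ (m - i));
          11 * (2 ^ i * 29 ^ (m - i))])%fset.

Definition subset_sums (U : {fset nat}) : {fset nat} :=
  [fset \sum_(b <- (B : {fset nat})) b | B in fpowerset U]%fset.

(* Main.v *)
Require Import Defs.
From mathcomp Require Import all_boot all_order all_algebra.
From mathcomp Require Import finmap.
From mathcomp Require Import reals ereal sequences.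
From mathcomp Require Import boolp classical_sets.
From mathcomp Require Import zify ring.
Import GRing.Theory Num.Theory Order.TTheory.

(** Three facts combine.

    A greedy sequence is determined by its set of values. If a 3-free unbounded
    set S starts with A, and every non-member of S beyond max A completes a
    progression whose two smaller terms are in S, then the greedy rule never
    accepts a non-member and never refuses a member, so S(A) enumerates S
    ([stanley_enum]).

    For A modular modulo N the set S is A + N T, where T is the set of integers
    whose ternary digits are all 0 or 1 ([stanley_modular]). It is 3-free since
    a progression in S reduces modulo N to one in A, which is constant, and
    then gives one in T, which is 3-free. It covers its complement because
    every n >= 0 is 2 j - k with k <= j in T, so a congruence
    x = 2 y - z modulo N with y, z in A lifts to an equality.

    The set A_m consists of the sums of the d_i 2^i 29^(m - i) with each d_i in
    D = {0, 2, 6, 8, 11, 13, 17, 19}, the subset sums of {2, 6, 11}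
    ([mem_subset_sums_generators]), and D is modular modulo 29. Writing A^n for
    the set with n digits, so that A_m = A^(m+1), two recursions are used:
    - A^(n+1) = 29 A^n + 2^n D shows the last digit modulo 29, and since 2 is
      invertible there, modularity modulo 29^n follows by induction
      ([digit_sum_modular]);
    - A^(n+1) = 29^n D + 2 A^n doubles the gaps at each step: elements with the
      same leading digit are twice as far apart as before, and different
      leading digits differ by at least 2, which leaves enough room because
      27 max A^n = 19 (29^n - 2^n). So distinct elements of A^n differ by at
      least 2^n ([digit_sum_gap]).

    The same bound on max A^n keeps consecutive translates of A^n by multiples
    of 29^n apart, so all gaps of S(A_m) are at least 2^(m+1). Equality occurs
    between N t and N t + 2^(m+1) for each t in T, hence infinitely often. *)

(** * Sets enumerated by the greedy rule *)

Definition initial_segment (S : nat -> Prop) (s : seq nat) : Prop :=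
  [/\ sorted ltn s, 0 < size s & forall x, x \in s <-> S x /\ x <= last 0 s].

(** What a set S must satisfy for the greedy rule, started from the part of S
    up to M, to enumerate S. *)
Definition saturated_three_free (S : nat -> Prop) (M : nat) : Prop :=
  [/\ forall x y z, S x -> S y -> S z -> x < y -> y < z -> x + z <> 2 * y,
      forall n, exists2 x, n < x & S x &
      forall x, M < x -> ~ S x ->
        exists y z, [/\ S y, S z, z < y & x + z = 2 * y]].

Lemma greedy_next_unique s x : is_greedy_next s x -> greedy_next s = x.
Proof.
move=> Px; apply: xget_unique => // y [y1 y2 y3].
case: Px => x1 x2 x3; apply/eqP; rewrite eqn_leq; apply/andP; split; auto.
Qed.

Lemma least_above {S : nat -> Prop} n :
  (forall n, exists2 x, n < x & S x) ->
  exists x, [/\ n < x, S x & forall y, n < y -> S y -> x <= y].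
Proof.
move=> unb; have ex: exists x, (n < x) && `[< S x >].
  by have [x nx Sx] := unb n; exists x; rewrite nx; apply/asboolP.
case: (ex_minnP ex) => x /andP[nx /asboolP Sx] xmin.
exists x; split=> // y ny Sy; apply: xmin; rewrite ny; exact/asboolP.
Qed.

(** A number strictly between the last term and the next element x of S is
    outside S, so it is the third term of a progression with two smaller terms
    in S; these lie below x, hence already in the segment, and the rule rejects
    the number. *)
Lemma greedy_extend_segment {S M s} :
  saturated_three_free S M -> initial_segment S s -> M <= last 0 s ->
  initial_segment S (greedy_extend s) /\ last 0 s < last 0 (greedy_extend s).
Proof.
move=> [free unb cov] [srt sz mem] leM.
have [x [lx Sx xmin]] := least_above (last 0 s) unb.
have memx w : w \in rcons s x <-> S w /\ w <= x.
  rewrite mem_rcons inE; split=> [/orP[/eqP->|/mem[Sw wl]]|[Sw wx]].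
  - by [].
  - by split=> //; lia.
  - case: (leqP w (last 0 s)) => wl; first by apply/orP; right; apply/mem.
    have := xmin w wl Sw; lia.
have next : greedy_next s = x.
  apply: greedy_next_unique; split=> //.
    by move=> a b c /memx[Sa _] /memx[Sb _] /memx[Sc _]; apply: free.
  move=> y ly fr; rewrite leqNgt; apply/negP => yx.
  have nSy : ~ S y by move=> /(xmin y ly); lia.
  have [b [c [Sb Sc cb e]]] := cov y (leq_ltn_trans leM ly) nSy.
  (* x is least, so members of S below y are at most the last term *)
  have low w : S w -> w < y -> w \in rcons s y.
    move=> Sw wy; rewrite mem_rcons inE; apply/orP; right; apply/mem.
    split=> //; rewrite leqNgt; apply/negP => lw.
    have := xmin w lw Sw; lia.
  have yy : y \in rcons s y by rewrite mem_rcons inE eqxx.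
  by apply: (fr c b y (low c Sc _) (low b Sb _) yy); lia.
rewrite /greedy_extend next last_rcons; split=> //; split.
- case: (s) srt sz lx => //= a l pl _ lx; rewrite rcons_path pl /=; lia.
- by rewrite size_rcons.
- by move=> w; rewrite last_rcons.
Qed.

Lemma ltn_nth_sorted {s i j} :
  sorted ltn s -> i < j -> j < size s -> nth 0 s i < nth 0 s j.
Proof.
by move=> srt ij js; apply: (sorted_ltn_nth ltn_trans) => //; apply: ltn_trans js.
Qed.

Lemma leq_nth_sorted {s i} : sorted ltn s -> i < size s -> i <= nth 0 s i.
Proof.
move=> srt; elim: i => // i IH si.
exact: leq_ltn_trans (IH (ltnW si)) (ltn_nth_sorted srt (ltnSn i) si).
Qed.

Lemma iter_greedy_extend {S} {A : {fset nat}} {M} n :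
  saturated_three_free S M -> M \in A -> (forall x, x \in A <-> S x /\ x <= M) ->
  let s := iter n greedy_extend (sort leq A) in
  [/\ initial_segment S s, M <= last 0 s & n < size s].
Proof.
move=> gS MA memA /=; elim: n => [|n [seg leM sz]] /=.
  have sA : sorted ltn (sort leq A).
    by rewrite ltn_sorted_uniq_leq sort_uniq fset_uniq (sort_sorted leq_total).
  have szA : 0 < size (sort leq A).
    by move: MA; rewrite -(mem_sort leq); case: (sort leq A).
  have lastM : last 0 (sort leq A) = M.
    have lA : last 0 (sort leq A) \in A.
      rewrite -(mem_sort leq); case: (sort leq A) szA => // a l _; exact: mem_last.
    apply/eqP; rewrite eqn_leq; apply/andP; split; first by case/memA: lA.
    have Ms : M \in sort leq A by rewrite mem_sort.
    rewrite -nth_last -{1}(nth_index 0 Ms).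
    have iM : index M (sort leq A) < size (sort leq A) by rewrite index_mem.
    have : index M (sort leq A) <= (size (sort leq A)).-1 by lia.
    rewrite leq_eqVlt => /orP[/eqP->//|lt].
    by apply: ltnW; apply: ltn_nth_sorted => //; lia.
  rewrite lastM; split=> //; split=> // x; rewrite mem_sort lastM; exact: memA.
have [seg' lt] := greedy_extend_segment gS seg leM.
by split=> //; [lia | rewrite size_rcons].
Qed.

Lemma nth_iter_greedy_extend s i k :
  i < size s -> nth 0 (iter k greedy_extend s) i = nth 0 s i.
Proof.
move=> si; have : forall k, size s <= size (iter k greedy_extend s).
  by elim=> //= {}k IH; rewrite size_rcons; lia.
move=> szk; elim: k => //= k <-; rewrite nth_rcons ifT //.
exact: leq_trans (szk k).
Qed.

Lemma stanley_enum {S} {A : {fset nat}} {M} :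
  saturated_three_free S M -> M \in A -> (forall x, x \in A <-> S x /\ x <= M) ->
  [/\ {homo stanley A : i j / i < j}, forall n, S (stanley A n) &
      forall x, S x -> exists n, stanley A n = x].
Proof.
move=> gS MA memA.
pose s n := iter n greedy_extend (sort leq A).
have inv n : [/\ initial_segment S (s n), M <= last 0 (s n) & n < size (s n)]
  by exact: (iter_greedy_extend n gS MA memA).
have nthE n k : stanley A n = nth 0 (s (k + n)) n.
  by rewrite /s iterD nth_iter_greedy_extend //; case: (inv n).
split.
- move=> i j ij; rewrite (nthE i (j - i)) (nthE j 0) subnK ?add0n; last exact: ltnW.
  by have [[srt _ _] _ sz] := inv j; apply: ltn_nth_sorted.
- move=> n; have [[_ _ mem] _ sz] := inv n.
  by have /mem[] := mem_nth 0 sz.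
- move=> x Sx; have [[srt sz0 mem] _ sz] := inv x.
  have xs : x \in s x.
    (* s x has more than x terms, so its last term is at least x *)
    apply/mem; split=> //; rewrite -nth_last.
    apply: leq_trans (leq_nth_sorted srt _); lia.
  have ix : index x (s x) < size (s x) by rewrite index_mem.
  have := leq_nth_sorted srt ix; rewrite nth_index // => lex.
  exists (index x (s x)); rewrite (nthE _ (x - index x (s x))) subnK //.
  exact: nth_index.
Qed.

(** * Modular Stanley sequences *)

Definition ternary01 (n : nat) : Prop := forall k, n %/ 3 ^ k %% 3 <= 1.

Lemma ternary01_step {q r} : r <= 1 -> ternary01 (3 * q + r) <-> ternary01 q.
Proof.
move=> r1; have divE k : (3 * q + r) %/ 3 ^ k.+1 = q %/ 3 ^ k.
  by rewrite expnS divnMA; congr (_ %/ _); lia.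
split=> T k; first by rewrite -divE.
by case: k => [|k]; [rewrite divn1; lia | rewrite divE].
Qed.

Lemma ternary01_split {n} :
  ternary01 n -> exists q r, [/\ r <= 1, n = 3 * q + r & ternary01 q].
Proof.
move=> T; have r1 := T 0; rewrite divn1 in r1.
exists (n %/ 3), (n %% 3); have nE : n = 3 * (n %/ 3) + n %% 3 by lia.
split=> //; apply/(ternary01_step r1); by rewrite -nE.
Qed.

Lemma ternary01_expn3 k : ternary01 (3 ^ k).
Proof.
elim: k => [|k IH]; last by rewrite expnS -[3 * _]addn0; apply/ternary01_step.
case=> [|k]; first by [].
by rewrite divn_small // ltn_exp2l.
Qed.

(** In x + z = 2 y no carry occurs, so each ternary digit of y is half of a sum
    of two digits 0 or 1, which forces these to be equal. *)
Lemma ternary01_three_free {x y z} : ternary01 x -> ternary01 y -> ternary01 z ->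
  x + z = 2 * y -> x = y.
Proof.
elim/ltn_ind: y x z => y IH x z Tx Ty Tz e.
have [y0|y0] := eqVneq y 0; first by lia.
have [a [r [r1 xE Ta]]] := ternary01_split Tx.
have [b [s [s1 yE Tb]]] := ternary01_split Ty.
have [c [t [t1 zE Tc]]] := ternary01_split Tz.
have ab : a = b by apply: (IH b _ a c) => //; lia.
lia.
Qed.

(** Digit by digit: 0 = 2 * 0 - 0, 1 = 2 * 1 - 1 and 2 = 2 * 1 - 0. *)
Lemma ternary01_cover n :
  exists j k, [/\ ternary01 j, ternary01 k, k <= j & n + k = 2 * j].
Proof.
elim/ltn_ind: n => n IH.
have [->|n0] := posnP n.
  by exists 0, 0; split=> // k; rewrite div0n.
have [|j [k [Tj Tk kj e]]] := IH (n %/ 3); first by lia.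
have [r0|[r1|r2]] : n %% 3 = 0 \/ n %% 3 = 1 \/ n %% 3 = 2 by lia.
- by exists (3 * j + 0), (3 * k + 0); split; try exact/ternary01_step; lia.
- by exists (3 * j + 1), (3 * k + 1); split; try exact/ternary01_step; lia.
- by exists (3 * j + 1), (3 * k + 0); split; try exact/ternary01_step; lia.
Qed.

Definition ternary_lift (N : nat) (A : {fset nat}) (x : nat) : Prop :=
  x %% N \in A /\ ternary01 (x %/ N).

Lemma eqz_modP {a b : int} {N : nat} :
  (a = b %[mod N%:Z])%Z <-> exists k : int, (a - b = k * N%:Z)%R.
Proof.
split=> [/eqP|h]; first by rewrite eqz_mod_dvd => /dvdzP.
by apply/eqP; rewrite eqz_mod_dvd; exact/dvdzP.
Qed.

Lemma ternary_liftP {N A} : modular_set N A -> forall x,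
  ternary_lift N A x <-> exists a t, [/\ a \in A, ternary01 t & x = a + t * N].
Proof.
move=> [N0 _ ltN _ _] x; split=> [[xA T]|[a [t [aA Tt ->]]]].
  by exists (x %% N), (x %/ N); split=> //; rewrite addnC -divn_eq.
by rewrite /ternary_lift addnC modnMDl divnMDl // modn_small ?divn_small ?addn0 ?ltN.
Qed.

(** For y, z in A with z < y, the value 2 y - z lies between 0 and 2 N, so when it
    is congruent to the residue r < N it is r or r + N. Accordingly the
    quotient of x by N, or its predecessor, must be written as 2 j - l with
    l <= j having ternary digits 0 and 1; the case r + N with quotient 0 is
    excluded because 2 y - z <= 2 M < x + N when x > M. *)
Lemma modular_saturated {N A M} : modular_set N A ->
  M \in A -> (forall x, x \in A -> x <= M) -> saturated_three_free (ternary_lift N A) M.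
Proof.
move=> modA MA maxM; have liftP := ternary_liftP modA.
case: modA => N0 A0 ltN free cov; split.
- move=> x y z /liftP[a [i [aA Ti ->]]] /liftP[b [j [bA Tj ->]]].
  move=> /liftP[c [k [cA Tk ->]]] xy yz e.
  have [|ab bc] := free a b c aA bA cA.
    by apply/eqz_modP; exists (i%:Z + k%:Z - 2 * j%:Z)%R; lia.
  have ij : i = j.
    apply: (ternary01_three_free Ti Tj Tk); apply/eqP.
    by rewrite -(eqn_pmul2r N0); apply/eqP; lia.
  by rewrite ab ij ltnn in xy.
- move=> n; exists (3 ^ n * N).
    by apply: leq_trans (leq_pmulr _ N0); apply: ltn_expl.
  by apply/liftP; exists 0, (3 ^ n); split=> //; apply: ternary01_expn3.
- move=> x Mx nSx; have xE := divn_eq x N; have xN : x %% N < N by rewrite ltn_mod.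
  have lift a t : a \in A -> ternary01 t -> ternary_lift N A (a + t * N).
    by move=> aA Tt; apply/liftP; exists a, t.
  case: (boolP (x %% N \in A)) => [xA|xA].
    have [j [k [Tj Tk kj e]]] := ternary01_cover (x %/ N).
    exists (x %% N + j * N), (x %% N + k * N); split; try exact: lift.
    + rewrite ltn_add2l ltn_pmul2r // ltn_neqAle kj andbT.
      apply/eqP => jk; apply: nSx; split=> //; suff -> : x %/ N = j by []; lia.
    + by have := congr1 (muln^~ N) e => /=; lia.
  have [y [z [yA zA zy /eqz_modP[k e]]]] := cov _ xN xA.
  have yM := maxM y yA; have yN := ltN y yA.
  have k01 : (k = 0 \/ k = 1)%R.
    have k0 : (-1 < k)%R by nia.
    have k2 : (k < 2)%R by nia.
    lia.
  case: k01 => kE; rewrite kE in e.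
    have [j [l [Tj Tl lj f]]] := ternary01_cover (x %/ N).
    exists (y + j * N), (z + l * N); split; try exact: lift.
      by apply: leq_trans (leq_add zy (leq_mul lj (leqnn N))); lia.
    by have := congr1 (muln^~ N) f => /=; lia.
  have q0 : 0 < x %/ N.
    by rewrite lt0n; apply/eqP => q0; rewrite q0 in xE; have := ltN M MA; lia.
  have [j [l [Tj Tl lj f]]] := ternary01_cover (x %/ N).-1.
  exists (y + j * N), (z + l * N); split; try exact: lift.
    by apply: leq_trans (leq_add zy (leq_mul lj (leqnn N))); lia.
  have f' : x %/ N + l = 2 * j + 1 by lia.
  by have := congr1 (muln^~ N) f' => /=; lia.
Qed.

Lemma stanley_modular {N A} : modular_set N A ->
  [/\ {homo stanley A : i j / i < j}, forall n, ternary_lift N A (stanley A n) &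
      forall x, ternary_lift N A x -> exists n, stanley A n = x].
Proof.
move=> modA; have [N0 A0 ltN _ _] := modA.
have exA : exists x, x \in A by exists 0.
have bndA x : x \in A -> x <= N by move=> /ltN/ltnW.
case: (ex_maxnP exA bndA) => M MA maxM.
have liftP := ternary_liftP modA.
apply: (stanley_enum (modular_saturated modA MA maxM) MA) => x; split=> [xA|[]].
  split; last exact: maxM.
  by apply/liftP; exists x, 0; split=> // [k|]; rewrite ?div0n ?mul0n ?addn0.
move=> /liftP[a [t [aA _ ->]]] le; have MN := ltN M MA.
by case: t le => [|t]; rewrite ?mul0n ?addn0 // mulSn; lia.
Qed.

(** * Mixed sums of digits *)

(** The subset sums of {2, 6, 11}, a modular set modulo 29. *)
Definition digits : seq nat := [:: 0; 2; 6; 8; 11; 13; 17; 19].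

(** With d i the i-th digit, n is the number of digits; the set A_m is
    [digit_sum m.+1]. The digits may exceed the ratio of consecutive weights, so
    this is not a positional numeral system. *)
Definition digit_sum (n x : nat) : Prop :=
  exists d : nat -> nat, (forall i, d i \in digits) /\
    x = \sum_(i < n) d i * (2 ^ i * 29 ^ (n - i.+1)).

Lemma digit_sum0 x : digit_sum 0 x <-> x = 0.
Proof.
split=> [[d [_ ->]]|->]; first by rewrite big_ord0.
by exists (fun=> 0); rewrite big_ord0.
Qed.

Lemma digit_sum_low {n x} : digit_sum n.+1 x <->
  exists a d, [/\ digit_sum n a, d \in digits & x = 29 * a + 2 ^ n * d].
Proof.
have step (d : nat -> nat) : \sum_(i < n.+1) d i * (2 ^ i * 29 ^ (n.+1 - i.+1)) =
    29 * (\sum_(i < n) d i * (2 ^ i * 29 ^ (n - i.+1))) + 2 ^ n * d n.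
  rewrite big_ord_recr /= subnn muln1 [d n * _]mulnC big_distrr /=; congr (_ + _).
  by apply: eq_bigr => i _; rewrite subSn // expnS; ring.
split=> [[d [dD ->]]|[a [e [[d [dD ->]] eD ->]]]].
  by exists (\sum_(i < n) d i * (2 ^ i * 29 ^ (n - i.+1))), (d n); split=> //; exists d.
exists (fun i => if i == n then e else d i); split=> [i|]; first by case: eqP.
rewrite (step (fun i => if i == n then e else d i)) eqxx.
congr (29 * _ + _); apply: eq_bigr => i _.
by rewrite ltn_eqF.
Qed.

Lemma digit_sum_high {n x} : digit_sum n.+1 x <->
  exists a d, [/\ digit_sum n a, d \in digits & x = 29 ^ n * d + 2 * a].
Proof.
have step (d : nat -> nat) : \sum_(i < n.+1) d i * (2 ^ i * 29 ^ (n.+1 - i.+1)) =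
    29 ^ n * d 0 + 2 * (\sum_(i < n) d i.+1 * (2 ^ i * 29 ^ (n - i.+1))).
  rewrite big_ord_recl /= subSS subn0 mul1n mulnC big_distrr /=; congr (_ + _).
  by apply: eq_bigr => i _; rewrite subSS expnS; ring.
split=> [[d [dD ->]]|[a [e [[d [dD ->]] eD ->]]]].
  exists (\sum_(i < n) d i.+1 * (2 ^ i * 29 ^ (n - i.+1))), (d 0); split=> //.
  by exists (fun i => d i.+1).
pose d' i := if i is j.+1 then d j else e.
by exists d'; split=> [[|i]|]; [|exact: dD|rewrite (step d')].
Qed.

Lemma digits_le {d} : d \in digits -> d <= 19.
Proof. by rewrite !inE; lia. Qed.

Lemma digits_three_free {d e f} : d \in digits -> e \in digits -> f \in digits ->
  2 * e = d + f %[mod 29] -> d = e /\ e = f.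
Proof.
have : all (fun d => all (fun e => all (fun f =>
  (2 * e == d + f %[mod 29]) ==> (d == e) && (e == f)) digits) digits) digits by [].
move=> /allP H /H/allP{}H /H/allP{}H /H /implyP{}H /eqP /H /andP[/eqP -> /eqP ->].
by [].
Qed.

Lemma digits_cover (r : int) : exists d e,
  [/\ d \in digits, e \in digits, e <= d &
      exists k : int, (2 * d%:Z - e%:Z = r + 29 * k)%R].
Proof.
have : all (fun r => has (fun d => has (fun e =>
  (e <= d) && (2 * d == r + e %[mod 29])) digits) digits) (iota 0 29) by [].
move=> /allP/(_ `|(r %% 29)%Z|); rewrite mem_iota => /(_ _)/wrap[]; first by lia.
move=> /hasP[d dD /hasP[e eD /andP[ed /eqP h]]].
exists d, e; split=> //; exists ((2 * d%:Z - e%:Z - r) %/ 29)%Z; lia.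
Qed.

Lemma digit_sum_bound {n x} : digit_sum n x -> 27 * x + 19 * 2 ^ n <= 19 * 29 ^ n.
Proof.
elim: n x => [|n IH] x; first by move=> /digit_sum0 ->.
move=> /digit_sum_low[a [d [/IH Ha /digits_le Hd ->]]].
by rewrite !expnS; nia.
Qed.

Lemma digit_sum_lt {n x} : digit_sum n x -> x < 29 ^ n.
Proof. by move/digit_sum_bound; have := expn_gt0 2 n; lia. Qed.

(** Splitting off the leading digit: equal leading digits reduce to the doubled
    gap of the tails, and leading digits differing by at least 2 leave
    2 * (29^n - max), which the bound on the maximum keeps above 2^(n+1). *)
Lemma digit_sum_gap {n x y} : digit_sum n x -> digit_sum n y -> x < y ->
  x + 2 ^ n <= y.
Proof.
elim: n x y => [|n IH] x y; first by move=> /digit_sum0 -> /digit_sum0 ->.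
move=> /digit_sum_high[a [d [Ha Hd ->]]] /digit_sum_high[b [e [Hb He ->]]] lt.
have le2 : 2 ^ n <= 29 ^ n by case: (n) => // k; rewrite leq_exp2r.
have Ba := digit_sum_bound Ha; have Bb := digit_sum_bound Hb.
have [de|de|de] := ltngtP d e; last 1 first.
- rewrite de in lt *; have := IH a b Ha Hb; rewrite expnS; lia.
- have de2 : d + 2 <= e by move: Hd He de; rewrite !inE; lia.
  rewrite expnS; nia.
- have de2 : e + 2 <= d by move: Hd He de; rewrite !inE; lia.
  nia.
Qed.

(** Modulo 29 only the last digits, scaled by the unit 2^n, remain; once they
    agree they cancel, and the congruence can be divided by 29. *)
Lemma digit_sum_three_free {n x y z} :
  digit_sum n x -> digit_sum n y -> digit_sum n z ->
  (exists k : int, 2 * y%:Z - z%:Z - x%:Z = k * (29 ^ n)%N%:Z)%R -> x = y /\ y = z.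
Proof.
elim: n x y z => [|n IH] x y z.
  by move=> /digit_sum0-> /digit_sum0-> /digit_sum0->.
move=> /digit_sum_low[a [d [Ha Hd ->]]] /digit_sum_low[b [e [Hb He ->]]].
move=> /digit_sum_low[c [f [Hc Hf ->]]] [k E].
have [de ef] : d = e /\ e = f.
  apply: digits_three_free => //.
  have : (29%:Z %| ((2 ^ n)%N%:Z * ((2 * e)%N%:Z - (d + f)%N%:Z))%R)%Z.
    apply/dvdzP; exists (k * (29 ^ n)%N%:Z - 2 * b%:Z + a%:Z + c%:Z)%R.
    by move: E; rewrite expnS; lia.
  rewrite Gauss_dvdzr; last by rewrite coprimezE /= coprimeXr.
  by rewrite -eqz_mod_dvd => /eqP /eqP; rewrite !modz_nat => /eqP [].
subst e f.
have [|-> ->] := IH a b c Ha Hb Hc; last by [].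
by exists k; move: E; rewrite expnS; lia.
Qed.

(** Taking x in the integers makes the induction go through: after the last
    digits are chosen, the quotient to be covered may be negative. The weak
    inequality z <= y, obtained digit by digit, lets a single statement treat
    members (y = z) and covered residues (z < y). *)
Lemma digit_sum_cover n (x : int) : exists y z k,
  [/\ digit_sum n y, digit_sum n z, z <= y &
      (2 * y%:Z - z%:Z - x = k * (29 ^ n)%N%:Z)%R].
Proof.
elim: n x => [|n IH] x.
  by exists 0, 0, (- x)%R; split; try exact/digit_sum0; lia.
(* 15 is the inverse of 2 modulo 29 *)
have [d [e [Hd He ed [j h]]]] := digits_cover (x * (15 ^ n)%N%:Z)%R.
have [q Hq] : exists q : int, ((2 ^ n)%N%:Z * (2 * d%:Z - e%:Z) = x + 29 * q)%R.
  have [u Hu] : exists u, 2 ^ n * 15 ^ n = 1 + 29 * u.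
    exists (30 ^ n %/ 29); rewrite -expnMn {1}(divn_eq (30 ^ n) 29).
    by rewrite -modnXm exp1n; lia.
  exists (u%:Z * x + (2 ^ n)%N%:Z * j)%R; rewrite h.
  by have := congr1 (fun v => x * v%:Z)%R Hu; rewrite PoszD !PoszM /=; lia.
have [y [z [k [Hy Hz zy E]]]] := IH (- q)%R.
exists (29 * y + 2 ^ n * d), (29 * z + 2 ^ n * e), k; split.
- by apply/digit_sum_low; exists y, d.
- by apply/digit_sum_low; exists z, e.
- by rewrite leq_add // leq_mul.
- by have := congr1 ( *%R 29)%R E; rewrite expnS; lia.
Qed.

(** * Subset sums of the generators *)

Lemma subset_sumsP {U : {fset nat}} {x} :
  x \in subset_sums U <-> exists P : pred nat, x = \sum_(b <- U | P b) b.
Proof.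
have filterE (B : {fset nat}) (P : pred nat) :
    (forall b, (b \in B) = (b \in U) && P b) ->
    \sum_(b <- B) b = \sum_(b <- U | P b) b.
  move=> BE; rewrite -[RHS]big_filter; apply: perm_big; apply: uniq_perm.
  - exact: fset_uniq.
  - by rewrite filter_uniq.
  - by move=> b; rewrite mem_filter BE andbC.
split=> [/imfsetP[/= B]|[P ->]].
  rewrite fpowersetE => /fsubsetP BU ->; exists (mem B); apply: filterE => b.
  by apply/idP/andP => [bB|[]//]; rewrite BU.
apply/imfsetP; exists [fset b in U | P b]%fset => /=.
  by rewrite fpowersetE; apply/fsubsetP => b; rewrite !inE => /andP[].
by symmetry; apply: filterE => b; rewrite !inE.
Qed.

(** The 29-adic valuation of a generator recovers its index i; this separates
    generators of different indices and lets a set of generators be defined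
    by a choice made for each index. *)
Lemma logn_weight {m i g} : i <= m -> g \in [:: 2; 6; 11] ->
  logn 29 (g * (2 ^ i * 29 ^ (m - i))) = m - i.
Proof.
move=> im gD; have g0 : 0 < g by move: gD; rewrite !inE; lia.
rewrite !lognM ?muln_gt0 ?expn_gt0 // lognX pfactorK // (logn_coprime (m := g)).
  by rewrite (logn_coprime (m := 2)) // muln0.
by move: gD; rewrite !inE => /or3P[] /eqP ->.
Qed.

Lemma perm_generators m : perm_eq (generators m)
  [seq g * (2 ^ i * 29 ^ (m - i)) | i <- iota 0 m.+1, g <- [:: 2; 6; 11]].
Proof.
apply: uniq_perm; first exact: fset_uniq.
  apply: allpairs_uniq; rewrite ?iota_uniq // => p q.
  move=> /allpairsP[[i g] [im gD ->]] /allpairsP[[j h] [jm hD ->]].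
  rewrite mem_iota /= in im; rewrite mem_iota /= in jm.
  rewrite /= in gD; rewrite /= in hD; move=> /= E.
  have ij : i = j by have := logn_weight (ltnSE im) gD; rewrite E logn_weight //; lia.
  move: E; rewrite ij => /eqP; rewrite eqn_pmul2r ?muln_gt0 ?expn_gt0 //.
  by move=> /eqP ->.
move=> b; apply/bigfcupP/allpairsP => /= [[i /andP[im _]]|[[i g] /= [im gD ->]]].
  by rewrite !inE => /orP[/orP[]|] /eqP ->;
     [exists (i, 2)|exists (i, 6)|exists (i, 11)]; split.
exists i; first by rewrite im.
by move: gD; rewrite !inE => /or3P[] /eqP ->; rewrite eqxx ?orbT.
Qed.

Lemma digit_choiceP d : d \in digits <->
  exists c : pred nat, d = \sum_(g <- [:: 2; 6; 11] | c g) g.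
Proof.
split=> [dD|[c ->]]; last first.
  by rewrite !big_cons !big_nil; case: (c 2); case: (c 6); case: (c 11).
have : has (fun c => d == \sum_(g <- [:: 2; 6; 11] | g \in c) g)
  [:: [::]; [:: 2]; [:: 6]; [:: 2; 6]; [:: 11]; [:: 2; 11]; [:: 6; 11]; [:: 2; 6; 11]].
  by move: dD; rewrite /= !big_cons !big_nil /= orbF !inE.
by move=> /hasP[c _ /eqP ->]; exists (mem c).
Qed.

Lemma mem_subset_sums_generators m x :
  x \in subset_sums (generators m) <-> digit_sum m.+1 x.
Proof.
have sumE (P : pred nat) : \sum_(b <- generators m | P b) b =
    \sum_(i < m.+1) (\sum_(g <- [:: 2; 6; 11] | P (g * (2 ^ i * 29 ^ (m - i)))) g) *
      (2 ^ i * 29 ^ (m - i)).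
  rewrite (perm_big _ (perm_generators m)) big_mkcond big_allpairs_dep.
  have -> : iota 0 m.+1 = index_iota 0 m.+1 by rewrite /index_iota subn0.
  rewrite big_mkord; apply: eq_bigr => i _.
  by rewrite big_distrl /= [RHS]big_mkcond.
split=> [/subset_sumsP[P ->]|[d [dD ->]]].
  exists (fun i => \sum_(g <- [:: 2; 6; 11] | P (g * (2 ^ i * 29 ^ (m - i)))) g).
  by split; [move=> i; apply/digit_choiceP; eexists | rewrite sumE].
have /choice[c cE] := fun i => (digit_choiceP (d i)).1 (dD i).
apply/subset_sumsP.
(* the valuation gives back the index of a generator, the quotient its factor *)
pose P b := let i := m - logn 29 b in c i (b %/ (2 ^ i * 29 ^ (m - i))).
exists P; rewrite sumE; apply: eq_bigr => i _; rewrite subSS; congr (_ * _).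
have im : i <= m by rewrite -ltnS.
rewrite cE big_seq_cond [RHS]big_seq_cond; apply: eq_bigl => g.
apply: andb_id2l => gD; rewrite /P logn_weight // subKn // mulnK //.
by rewrite muln_gt0 !expn_gt0.
Qed.

(** * Modularity and gaps *)

Lemma digit_sum_modular {n} {A : {fset nat}} : (forall x, x \in A <-> digit_sum n x) ->
  modular_set (29 ^ n) A.
Proof.
move=> AP; split.
- by rewrite expn_gt0.
- apply/AP; exists (fun=> 0); split=> //.
  by rewrite big1 // => i _; rewrite mul0n.
- by move=> x /AP /digit_sum_lt.
- move=> x y z /AP Hx /AP Hy /AP Hz /eqz_modP.
  exact: digit_sum_three_free.
- move=> x xN xA; have [y [z [k [Hy Hz zy E]]]] := digit_sum_cover n x.
  exists y, z; split; try exact/AP; last by apply/eqz_modP; exists k.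
  rewrite ltn_neqAle zy andbT; apply/eqP => zE; case/negP: xA; apply/AP.
  suff -> : x = y by [].
  have yN := digit_sum_lt Hy; subst z.
  have : (-1 < k)%R by nia.
  have : (k < 1)%R by nia.
  move=> k1 k2; have k0 : k = 0%R by lia.
  by rewrite k0 in E; lia.
Qed.

(** Within one translate of A this is the gap of A; between translates the room
    left is at least 29^n - max A, and 27 (29^n - max A) >= 8 * 29^n + 19 * 2^n. *)
Lemma ternary_lift_gap {n} {A : {fset nat}} {x y} :
  (forall x, x \in A <-> digit_sum n x) ->
  ternary_lift (29 ^ n) A x -> ternary_lift (29 ^ n) A y -> x < y -> x + 2 ^ n <= y.
Proof.
move=> AP; have liftP := ternary_liftP (digit_sum_modular AP).
move=> /liftP[a [s [/AP Ha _ ->]]] /liftP[b [t [/AP Hb _ ->]]] lt.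
have aN := digit_sum_lt Ha; have bN := digit_sum_lt Hb.
have [st|ts|st] := ltngtP s t.
- have := digit_sum_bound Ha.
  have := leq_mul st (leqnn (29 ^ n)).
  have : 2 ^ n <= 29 ^ n by case: (n) => // k; rewrite leq_exp2r.
  rewrite mulSn; lia.
- have := leq_mul ts (leqnn (29 ^ n)); rewrite mulSn; lia.
- by subst t; have := digit_sum_gap Ha Hb; lia.
Qed.

Local Open Scope classical_set_scope.

Lemma limn_einf_attained {R : realType} (u : nat -> \bar R) (l : \bar R) :
  (forall n, l <= u n)%E -> (forall n, exists2 k, n <= k & u k = l) ->
  limn_einf u = l.
Proof.
move=> lb att; rewrite limn_einf_lim.
suff -> : einfs u = fun=> l by exact: lim_cst.
apply/funext => n; apply/eqP; rewrite eq_le; apply/andP; split.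
  have [k nk <-] := att n.
  by apply: ereal_inf_lbound; exists k.
by apply: le_ereal_inf_tmp => _ [k _ <-].
Qed.

Theorem corollary5p2 (R : realType) (m : nat) :
  let A := subset_sums (generators m) in
  modular_set (29 ^ m.+1) A /\
  limn_einf (fun n : nat =>
    (((stanley A n.+1)%:R - (stanley A n)%:R : R)%R)%:E) =
  ((2 ^+ m.+1 : R)%R)%:E.
Proof.
move=> A; have AP : forall x, x \in A <-> digit_sum m.+1 x
  by exact: mem_subset_sums_generators.
have modA := digit_sum_modular AP; split=> //.
have [incr sub sur] := stanley_modular modA; have liftP := ternary_liftP modA.
have gap i j : i < j -> stanley A i + 2 ^ m.+1 <= stanley A j.
  by move=> /incr; apply: ternary_lift_gap.
apply: limn_einf_attained => n.
  have ij := gap n _ (ltnSn n).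
  by rewrite lee_fin lerBrDl -natrX -natrD ler_nat.
(* a power of 3 so large that the translate of A by t N lies beyond a_n *)
pose t := 3 ^ stanley A n.
have lift a : a \in A -> exists k, stanley A k = a + t * 29 ^ m.+1.
  by move=> aA; apply: sur; apply/liftP; exists a, t; split=> //; apply: ternary01_expn3.
have [|k kE] := lift 0; first by case: modA.
have [|l lE] := lift (2 ^ m.+1).
  apply/AP/digit_sum_low; exists 0, 2; split=> //.
    exists (fun=> 0); split=> //; by rewrite big1 // => i _; rewrite mul0n.
  by rewrite expnSr; lia.
(* a term strictly between would split this minimal gap *)
have kl : l = k.+1.
  have := gap k k.+1 (ltnSn k); have p0 : 0 < 2 ^ m.+1 by rewrite expn_gt0.
  have [lk|lk|//] := ltngtP l k.+1; last by have := incr _ _ lk; lia.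
  have [/incr|lk'] := ltnP l k; first by lia.
  have lkE : l = k by lia.
  by rewrite lkE kE in lE; lia.
exists k.
  rewrite leqNgt; apply/negP => /incr; rewrite kE.
  have := leq_pmulr t (expn_gt0 29 m.+1); have := ltn_expl (stanley A n) (isT : 1 < 3).
  by rewrite -/t; lia.
by congr EFin; rewrite -kl kE lE add0n natrD addrK natrX.
Qed.
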